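(* Let $X$ be a vector space over $\mathbb{R}$ or $\mathbb{C}$, let $\rho : X \to [0,+\infty]$ be a modular satisfying the $\Delta_2$-condition and the Fatou property, let $X_\rho$ be the associated modular space with its topology $\tau$, let $A \subset X_\rho$ be a closed subset (for $\tau$), and let $x_0 \in X_\rho$ with $x_0 \notin A$. Then there exists an open neighbourhood $V_{x_0}$ of $x_0$ (for $\tau$) such that $\overline{V_{x_0}}^{\rho} \cap A = \emptyset$, where $\overline{V_{x_0}}^{\rho}$ denotes the closure of $V_{x_0}$ for $\tau$.
   Context: A modular on a vector space $X$ over $\mathbb{R}$ or $\mathbb{C}$ is a map $\rho : X \to [0,+\infty]$ such that for all $x,y \in X$: (i) $\rho(x) = 0$ if and only if $x = 0$; (ii) $\rho(-x) = \rho(x)$ in the real case, and $\rho(e^{it}x) = \rho(x)$ for all $t \in \mathbb{R}$ in the complex case; (iii) $\rho(\alpha x + \beta y) \le \rho(x) + \rho(y)$ whenever $\alpha, \beta \ge 0$ and $\alpha + \beta = 1$. The associated modular space is $X_\rho = \{x \in X : \rho(\lambda x) \to 0 \text{ as } \lambda \to 0\}$, a vector subspace of $X$. $\Delta_2$-condition: for every sequence $(x_n)_{n \in \mathbb{N}}$ in $X_\rho$, if $\lim_{n\to\infty} \rho(x_n) = 0$ then $\lim_{n\to\infty} \rho(2x_n) = 0$. $\rho$-convergence: for $x_n, x \in X_\rho$, $x_n \stackrel{\rho}{\longrightarrow} x$ means that there exists $\lambda > 0$ such that $\rho(\lambda(x_n - x)) \to 0$ as $n \to \infty$. Fatou property: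 whenever $x_n \stackrel{\rho}{\longrightarrow} x$ and $y_n \stackrel{\rho}{\longrightarrow} y$ in $X_\rho$, one has $\rho(x-y) \le \liminf_{n\to\infty} \rho(x_n - y_n)$. Topology: for $r > 0$ let $B_\rho(0,r) = \{x \in X_\rho : \rho(x) < r\}$ and let $\mathcal{B} = \{B_\rho(0,r) : r > 0\}$. The topology $\tau$ on $X_\rho$ is $\tau = \{G \subset X_\rho : \text{for every } x \in G \text{ there exists } V \in \mathcal{B} \text{ with } x + V \subset G\}$ (it contains $\emptyset$). A set is closed for $\tau$ if its complement in $X_\rho$ belongs to $\tau$. *)

(* Defs.v *)
From HB Require Import structures.
From mathcomp Require Import all_boot all_order all_algebra.
From mathcomp Require Import complex.
From mathcomp Require Import all_classical all_reals all_analysis.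

Set Implicit Arguments.
Unset Strict Implicit.
Unset Printing Implicit Defensive.

Import Order.TTheory GRing.Theory Num.Theory.
Import numFieldNormedType.Exports.

Local Open Scope classical_set_scope.
Local Open Scope ring_scope.

Inductive scalar_kind := RealScalars | ComplexScalars.

Definition scalars (R : realType) (k : scalar_kind) : numFieldType :=
  match k with
  | RealScalars => R : numFieldType
  | ComplexScalars => R[i]%C : numFieldType
  end.

Definition phase_invariant (R : realType) (k : scalar_kind) :
    forall X : lmodType (scalars R k), (X -> \bar R) -> Prop :=
  match k with
  | RealScalars => fun X rho => forall x : X, rho (- x) = rho x
  | ComplexScalars => fun X rho =>
      forall (t : R) (x : X), rho ((cos t +i* sin t)%C *: x) = rho x
  end.

Section Modular.
Variables (R : realType) (k : scalar_kind) (X : lmodType (scalars R k)).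
Variable rho : X -> \bar R.

(* In the order of [R[i]], [0 <= a] holds only when [a] is real, so [a] and
   [b] below range over the nonnegative reals in the complex case as well. *)
Definition is_modular : Prop :=
  [/\ forall x, (0 <= rho x)%E,
      forall x, rho x = 0%E <-> x = 0,
      phase_invariant rho
    & forall (a b : scalars R k) (x y : X), 0 <= a -> 0 <= b -> a + b = 1 ->
        (rho (a *: x + b *: y) <= rho x + rho y)%E].

Definition modular_space : set X :=
  [set x | rho (l *: x) @[l --> (0 : scalars R k)^'] --> 0%E].

Definition Delta2 : Prop :=
  forall u : nat -> X, (forall n, modular_space (u n)) ->
    rho (u n) @[n --> \oo] --> 0%E ->
    rho (2%:R *: u n) @[n --> \oo] --> 0%E.

(* As above, [0 < l] forces [l] to be real. *)
Definition modular_cvg (u : nat -> X) (x : X) : Prop :=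
  exists2 l : scalars R k, 0 < l & rho (l *: (u n - x)) @[n --> \oo] --> 0%E.

Definition Fatou : Prop :=
  forall (u v : nat -> X) (x y : X),
    (forall n, modular_space (u n)) -> (forall n, modular_space (v n)) ->
    modular_space x -> modular_space y ->
    modular_cvg u x -> modular_cvg v y ->
    (rho (x - y)%R <= limn_einf (fun n => rho (u n - v n)%R))%E.

Definition modular_ball (r : R) : set X :=
  [set x | modular_space x /\ (rho x < r%:E)%E].

Definition modular_open (G : set X) : Prop :=
  G `<=` modular_space /\
  forall x, G x -> exists2 r : R, 0 < r &
    [set x + v | v in modular_ball r] `<=` G.

Definition modular_closed (F : set X) : Prop :=
  F `<=` modular_space /\ modular_open (modular_space `\` F).

Definition modular_closure (S : set X) : set X := smallest modular_closed S.

End Modular.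

(* Main.v *)
Require Import Defs.
From HB Require Import structures.
From mathcomp Require Import all_boot all_order all_algebra.
From mathcomp Require Import complex.
From mathcomp Require Import all_classical all_reals all_analysis.

Import Order.TTheory GRing.Theory Num.Theory.
Import numFieldNormedType.Exports.

Local Open Scope classical_set_scope.
Local Open Scope ring_scope.

(** The Delta2-condition makes addition continuous at 0: since
    rho (x + y) <= rho (2 x) + rho (2 y), for every r there is d with
    B(0,d) - B(0,d) contained in B(0,r).  Hence the points x such that
    x + B(0,s) is contained in S for some s form an open set, the interior
    of S.  If x0 + B(0,r) misses A, then for each a in A the interiors of
    x0 + B(0,d) and a + B(0,d) are disjoint neighbourhoods of x0 and a, so
    that a is not in the closure of the former. *)

(** Serves to rescale the limit that defines [modular_space]; [a != 0] keeps [a * l] away from the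
    excluded point 0. *)
Lemma cvg_dnbhs0Ml {K : numFieldType} {a : K} : a != 0 ->
  a * l @[l --> (0 : K)^'] --> (0 : K)^'.
Proof.
move=> a0 P /nbhs_ballP[e /= e0 eP].
apply/nbhs_ballP; exists (e / `|a|) => /=; first by rewrite divr_gt0 ?normr_gt0.
move=> l /=; rewrite -ball_normE /ball_ /= sub0r normrN => le l0.
apply: eP; last by rewrite mulf_neq0.
by rewrite -ball_normE /ball_ /= sub0r normrN normrM mulrC -ltr_pdivlMr ?normr_gt0.
Qed.

Section ModularSpace.
Set Implicit Arguments.
Unset Strict Implicit.
Context {R : realType} {k : scalar_kind} {X : lmodType (scalars R k)}.
Variable rho : X -> \bar R.
Hypothesis rho_modular : is_modular rho.

Lemma modular_ge0 x : (0 <= rho x)%E.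
Proof. by case: rho_modular. Qed.

Lemma modular0 : rho 0 = 0%E.
Proof. by case: rho_modular => _ /(_ 0)[_ ->]. Qed.

(** The sum is the midpoint of the two doubled vectors, so convexity with both weights 1/2
    applies. *)
Lemma modularD x y : (rho (x + y) <= rho (2%:R *: x) + rho (2%:R *: y))%E.
Proof.
have [_ _ _ rhoD] := rho_modular.
have /(rhoD 2^-1 2^-1 (2%:R *: x) (2%:R *: y)) : 0 <= 2^-1 :> scalars R k.
  by rewrite invr_ge0.
rewrite !scalerA mulVf ?pnatr_eq0// !scale1r; apply.
  by rewrite invr_ge0.
by rewrite -[RHS](@mulfV _ 2) ?pnatr_eq0// mulr2n mulrDl mul1r.
Qed.

Lemma modularN x : rho (- x) = rho x.
Proof.
have [_ _ + _] := rho_modular.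
case: k X rho x => X' rho' x /=; first exact.
(* In the complex case, -1 is the phase exp(i t) at [t = pi]. *)
move=> /(_ pi x); rewrite cospi sinpi -scaleN1r => <-.
by congr (rho' (_ *: _)); apply/eqP; rewrite eq_complex /= oppr0 !eqxx.
Qed.

Lemma modular_space0 : modular_space rho 0.
Proof.
rewrite /modular_space /=.
under eq_fun do rewrite scaler0 modular0.
exact: cvg_cst.
Qed.

Lemma modular_spaceN x : modular_space rho x -> modular_space rho (- x).
Proof.
rewrite /modular_space /= => xX.
by under eq_fun do rewrite scalerN modularN.
Qed.

Lemma modular_spaceZ a x : modular_space rho x -> modular_space rho (a *: x).
Proof.
have [->|a0] := eqVneq a 0; first by rewrite scale0r => _; exact: modular_space0.
rewrite /modular_space /= => xX.
under eq_fun do rewrite scalerA mulrC.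
exact: (cvg_comp (fun l => a * l) (fun l => rho (l *: x)) (cvg_dnbhs0Ml a0) xX).
Qed.

Lemma modular_spaceD x y :
  modular_space rho x -> modular_space rho y -> modular_space rho (x + y).
Proof.
move=> /(modular_spaceZ 2%:R) xX /(modular_spaceZ 2%:R) yX.
rewrite /modular_space /=.
apply: (@squeeze_cvge _ _ _ _ (cst 0%E) _
    (fun l => rho (l *: (2%:R *: x)) + rho (l *: (2%:R *: y)))%E).
- apply: nearW => l /=; rewrite modular_ge0 /= scalerDr (le_trans (modularD _ _))//.
  by rewrite !scalerA ![l * _]mulrC.
- exact: cvg_cst.
- by rewrite -[X in _ --> X]adde0; apply: cvgeD.
Qed.

Definition modular_interior (S : set X) : set X :=
  [set x | modular_space rho x /\ exists2 r : R, 0 < r &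
    [set x + v | v in modular_ball rho r] `<=` S].

Lemma modular_ball0 (r : R) : 0 < r -> modular_ball rho r 0.
Proof. by move=> r0; split; [exact: modular_space0|rewrite modular0 lte_fin]. Qed.

Lemma modular_ballN (r : R) x : modular_ball rho r x -> modular_ball rho r (- x).
Proof. by move=> [/modular_spaceN xX xr]; split=> //; rewrite modularN. Qed.

Lemma modular_interior_sub (S : set X) : modular_interior S `<=` S.
Proof.
move=> x [_ [r r0]]; apply; exists 0; [exact: modular_ball0|exact: addr0].
Qed.

Hypothesis rho_Delta2 : Delta2 rho.

(** Turns the sequential condition into one on balls. If no [d] works, picking a counterexample in
    each ball of radius 1/(n+1) gives a sequence whose modulars tend to 0 while those of its doubles
    stay at least [e]. *)
Lemma Delta2_ball (e : R) : 0 < e -> exists2 d : R, 0 < d &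
  forall x, modular_ball rho d x -> modular_ball rho e (2%:R *: x).
Proof.
move=> e0; apply: contrapT => nod.
have /choice[u uP] : forall n : nat, exists x : X,
    modular_ball rho n.+1%:R^-1 x /\ (e%:E <= rho (2%:R *: x))%E.
  move=> n; apply: contrapT => nox; apply: nod.
  exists n.+1%:R^-1 => [|x xd]; first by rewrite invr_gt0.
  split; first by apply: modular_spaceZ; case: xd.
  by rewrite ltNge; apply/negP => ex; apply: nox; exists x.
have u0 : rho (u n) @[n --> \oo] --> 0%E.
  apply: (@squeeze_cvge _ _ _ _ (cst 0%E) _ (EFin \o harmonic)).
  - apply: nearW => n; have [[_ un] _] := uP n.
    by rewrite modular_ge0 /= ltW.
  - exact: cvg_cst.
  - exact: cvge_harmonic.
have u20 := rho_Delta2 (fun n => (uP n).1.1) u0.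
have : (e%:E <= limn (fun n => rho (2%:R *: u n)))%E.
  apply: lime_ge; first by apply/cvg_ex; exists 0%E.
  by apply: nearW => n; case: (uP n).
by rewrite (cvg_lim _ u20)// lee_fin leNgt e0.
Qed.

Lemma modular_ballD (r : R) : 0 < r -> exists2 d : R, 0 < d &
  forall x y, modular_ball rho d x -> modular_ball rho d y ->
    modular_ball rho r (x + y).
Proof.
move=> r0; have [d d0 dP] := @Delta2_ball (r / 2) (divr_gt0 r0 (ltr0n _ 2)).
exists d => // x y xd yd; split.
  by apply: modular_spaceD; [case: xd|case: yd].
have [_ x2] := dP _ xd; have [_ y2] := dP _ yd.
by rewrite (le_lt_trans (modularD _ _))// [r]splitr EFinD lteD.
Qed.

Lemma modular_interior_open (S : set X) : modular_open rho (modular_interior S).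
Proof.
split=> [x []//|x [xX [r r0 xS]]].
have [d d0 dP] := modular_ballD r0.
exists d => // _ [v vd <-]; split; first by apply: modular_spaceD => //; case: vd.
exists d => // _ [w wd <-]; apply: xS; exists (v + w); first exact: dP.
by rewrite addrA.
Qed.

End ModularSpace.

Theorem mainTheorem5 (R : realType) (k : scalar_kind)
    (X : lmodType (scalars R k)) (rho : X -> \bar R)
    (rho_modular : is_modular rho) (rho_Delta2 : Delta2 rho)
    (rho_Fatou : Fatou rho)
    (A : set X) (A_closed : modular_closed rho A)
    (x0 : X) (x0_space : modular_space rho x0) (x0_notin_A : ~ A x0) :
  exists V : set X,
    [/\ modular_open rho V, V x0 & modular_closure rho V `&` A = set0].
Proof.
have [AX [_ /(_ x0 (conj x0_space x0_notin_A))[r r0 x0A]]] := A_closed.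
have [d d0 dP] := modular_ballD rho_modular rho_Delta2 r0.
(* A translated ball is not shown to be open, hence the passage to its interior. *)
pose N x := modular_interior rho [set x + v | v in modular_ball rho d].
have N_open x : modular_open rho (N x) by exact: modular_interior_open.
have Nx x : modular_space rho x -> N x x by split=> //; exists d.
exists (N x0); split; [exact: N_open|exact: Nx|].
rewrite -subset0 => a [clVa Aa].
(* The closure lies in every closed set containing [N x0]. The complement of [N a] is such a set,
   yet [a] belongs to [N a]. *)
suff : (modular_space rho `\` N a) a by case=> _; apply; apply/Nx/AX.
apply: clVa; split; first split.
- exact: subDsetl.
- by rewrite setDD setIidr; [exact: N_open|case: (N_open a)].
- move=> y Vy; split; first by case: Vy.
  move=> /(modular_interior_sub rho_modular)[v vd yv].
  have [w wd yw] := modular_interior_sub rho_modular Vy.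
  (* A common point [y = a + v = x0 + w] gives [a = x0 + (w - v)], a point of x0 + B(0,r), which
     misses [A]. *)
  have : (modular_space rho `\` A) a; last by case.
  apply: x0A; exists (w - v); first by apply/dP/modular_ballN.
  by rewrite addrA yw -yv addrK.
Qed.
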